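(* SESs are strictly less expressive than RCESs: for every SES $\sigma$ there is an RCES that is transition equivalent to $\sigma$, and there is an RCES that is not transition equivalent to any SES.
   Context: An SES is a tuple $\sigma=(E,\#,\to,\mathrm{Drop})$: $E$ a set of events, $\#\subseteq E^2$ irreflexive and symmetric, $\to\subseteq E^2$, $\mathrm{Drop}\subseteq E^3$ with $(d,c,t)\in\mathrm{Drop}$ implying $c\to t$ and $d\notin\{c,t\}$. Let $\mathrm{ic}(e)=\{e'\mid e'\to e\}$, $\mathrm{dc}(H,e)=\{e'\mid\exists d\in H.(d,e',e)\in\mathrm{Drop}\}$. $X\mapsto_\sigma Y$ iff $X\subsetneq Y$, no two events of $Y$ are in conflict, and $\mathrm{ic}(e)\setminus\mathrm{dc}(X,e)\subseteq X$ for all $e\in Y\setminus X$; $\mathcal C(\sigma)$ is the set of finite $X\subseteq E$ with $\emptyset\mapsto_\sigma^* X$. An Event Structure for Resolvable Conflicts (RCES) is $\rho=(E,\vdash)$ with $E$ a set of events and $\vdash\subseteq\mathcal P(E)^2$. For $X,Y\subseteq E$: $X\mapsto_\rho Y$ iff $X\subsetneq Y$ and for every $Z\subseteq Y$ there is $W\subseteq X$ with $W\vdash Z$. $\mathcal C(\rho)$ is the set of finite $X$ with $\emptyset\mapsto_\rho^*X$. Two structures $\mu_1,\mu_2$ of these kinds are transition equivalent if they have the same reachable transition graph: $\mathcal C(\mu_1)=\mathcal C(\mu_2)$ and $\mapsto_{\mu_1}\cap\,\mathcal C(\mu_1)^2=\mapsto_{\mu_2}\cap\,\mathcal C(\mu_2)^2$.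 *)

(* Defs.v *)
From mathcomp Require Import all_boot.
From mathcomp Require Import boolp classical_sets functions cardinality.
From Stdlib Require Import Relation_Operators.

Set Implicit Arguments.
Unset Strict Implicit.
Unset Printing Implicit Defensive.

Local Open Scope classical_set_scope.

(* Event sets are arbitrary subsets of an ambient type U, so that structures
   with different event sets can be compared by plain equality of their
   configurations and transitions. *)

(* What SESs and RCESs have in common: a set of events together with a
   transition relation on sets of events. *)
Record tstruct (U : Type) := TStruct {
  events : set U;
  step : set U -> set U -> Prop
}.

Definition configs (U : Type) (mu : tstruct U) : set (set U) :=
  [set X | [/\ X `<=` events mu, finite_set X &
               clos_refl_trans (set U) (step mu) set0 X]].

Definition reach_steps (U : Type) (mu : tstruct U) : set (set U * set U) :=
  [set p | step mu p.1 p.2] `&` (configs mu `*` configs mu).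

Definition trans_equiv (U : Type) (mu1 mu2 : tstruct U) : Prop :=
  configs mu1 = configs mu2 /\ reach_steps mu1 = reach_steps mu2.

Record SES (U : Type) := MkSES {
  ses_E : set U;
  ses_conf : U -> U -> Prop;
  ses_caus : U -> U -> Prop;
  ses_drop : U -> U -> U -> Prop;
  ses_confE : forall e e', ses_conf e e' -> ses_E e /\ ses_E e';
  ses_conf_irr : forall e, ~ ses_conf e e;
  ses_conf_sym : forall e e', ses_conf e e' -> ses_conf e' e;
  ses_causE : forall e e', ses_caus e e' -> ses_E e /\ ses_E e';
  ses_dropE : forall d c t, ses_drop d c t -> [/\ ses_E d, ses_E c & ses_E t];
  ses_dropP : forall d c t,
    ses_drop d c t -> ses_caus c t /\ ~ [set c; t] d
}.

Definition ses_ic (U : Type) (s : SES U) (e : U) : set U :=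
  [set e' | ses_caus s e' e].

Definition ses_dc (U : Type) (s : SES U) (H : set U) (e : U) : set U :=
  [set e' | exists2 d, H d & ses_drop s d e' e].

Definition ses_step (U : Type) (s : SES U) (X Y : set U) : Prop :=
  [/\ Y `<=` ses_E s,
      X `<` Y,
      forall e e', Y e -> Y e' -> ~ ses_conf s e e' &
      forall e, (Y `\` X) e -> ses_ic s e `\` ses_dc s X e `<=` X].

Definition ses_ts (U : Type) (s : SES U) : tstruct U :=
  TStruct (ses_E s) (ses_step s).

Record RCES (U : Type) := MkRCES {
  rces_E : set U;
  rces_en : set U -> set U -> Prop;
  rces_enE : forall W Z, rces_en W Z -> W `<=` rces_E /\ Z `<=` rces_E
}.

Definition rces_step (U : Type) (r : RCES U) (X Y : set U) : Prop :=
  [/\ Y `<=` rces_E r,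
      X `<` Y &
      forall Z, Z `<=` Y -> exists2 W, W `<=` X & rces_en r W Z].

Definition rces_ts (U : Type) (r : RCES U) : tstruct U :=
  TStruct (rces_E r) (rces_step r).

(* Main.v *)
(* In an SES the enabling condition of an event is monotone in the set of
   events that already happened, since more events mean more satisfied causes
   and more droppers.  Hence on reachable sets every event that has happened is
   still enabled, and a step to [Y] only asks that [Y] be conflict-free and that
   all its events be enabled: this is an RCES enabling relation.
   Conversely, the RCES on two events in which each can occur first, and [b]
   after [a], but not both at once, is no SES: the step from [{a}] to [{a, b}]
   excludes a conflict, both events are enabled initially, and so an SES would
   also allow the step from [set0] to [{a, b}]. *)
Require Import Defs.
From mathcomp Require Import all_boot.
From mathcomp Require Import boolp classical_sets functions cardinality.
From Stdlib Require Import Relation_Operators Operators_Properties.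

Set Implicit Arguments.
Unset Strict Implicit.
Unset Printing Implicit Defensive.

Local Open Scope classical_set_scope.

Section TransitionStructures.
Variable U : Type.
Implicit Types (mu : tstruct U) (X Y : set U).

Lemma configs0 mu : configs mu set0.
Proof. by split; [exact: sub0set | exact: finite_set0 | exact: rt_refl]. Qed.

Lemma configs_step mu X Y : configs mu X -> step mu X Y ->
  Y `<=` events mu -> finite_set Y -> configs mu Y.
Proof.
move=> [_ _ X0] XY YE Yfin; split => //.
by apply: rt_trans X0 _; apply: rt_step.
Qed.

Lemma reach_invariant mu (P : set U -> Prop) :
  P set0 -> (forall X Y, P X -> step mu X Y -> P Y) ->
  forall X, clos_refl_trans (set U) (step mu) set0 X -> P X.
Proof.
move=> P0 Pstep X /(clos_rt_rtn1 _ _ _ _).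
by elim=> // Y Z YZ _ PY; apply: Pstep PY YZ.
Qed.

(** The two step relations are compared only at sources satisfying [P]; this suffices because [P]
    propagates along every path from [set0]. *)
Lemma reach_steps_sub_invariant mu1 mu2 (P : set U -> Prop) :
  events mu1 `<=` events mu2 -> P set0 ->
  (forall X Y, P X -> step mu1 X Y -> P Y /\ step mu2 X Y) ->
  configs mu1 `<=` configs mu2 /\ reach_steps mu1 `<=` reach_steps mu2.
Proof.
move=> E12 P0 S12.
have P1 : forall X, clos_refl_trans (set U) (step mu1) set0 X -> P X.
  by apply: reach_invariant => // X Y PX /(S12 _ _ PX)[].
have C12 : configs mu1 `<=` configs mu2.
  move=> X [XE Xfin X0]; split=> //; first exact: subset_trans XE E12.
  (* Paths are unfolded at their last step, whose source [Y] is reachable and hence satisfies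
     [P]. *)
  move: X0 => /(clos_rt_rtn1 _ _ _ _); elim=> {X XE Xfin}.
    exact: rt_refl.
  move=> Y Z YZ /(clos_rtn1_rt _ _ _ _) /P1 PY IH.
  by apply: rt_trans IH (rt_step _ _ _ _ _); case: (S12 _ _ PY YZ).
split=> // -[X Y] [/= XY [XC YC]]; split; last by split; apply: C12.
by case: XC => _ _ /P1 PX; case: (S12 _ _ PX XY).
Qed.

Lemma trans_equiv_invariant mu1 mu2 (P : set U -> Prop) :
  events mu1 = events mu2 -> P set0 ->
  (forall X Y, P X -> step mu1 X Y -> P Y) ->
  (forall X Y, P X -> step mu1 X Y <-> step mu2 X Y) ->
  trans_equiv mu1 mu2.
Proof.
move=> E12 P0 P1 S12.
have [||C12 R12] := @reach_steps_sub_invariant mu1 mu2 P _ P0.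
- by rewrite E12.
- by move=> X Y PX XY; split; [apply: P1 PX XY | apply/S12].
have [||C21 R21] := @reach_steps_sub_invariant mu2 mu1 P _ P0.
- by rewrite E12.
- by move=> X Y PX /(S12 _ _ PX) XY; split=> //; apply: P1 PX XY.
by split; apply/seteqP.
Qed.

End TransitionStructures.

Section SESToRCES.
Variables (U : Type) (s : SES U).
Implicit Types (X Y W Z : set U) (e : U).

Definition ses_enabled X e : Prop := ses_ic s e `\` ses_dc s X e `<=` X.

Lemma ses_enabled_mono X Y e : X `<=` Y -> ses_enabled X e -> ses_enabled Y e.
Proof.
move=> XY Xe c [ce ndc]; apply/XY/Xe; split=> // -[d Xd dce].
by apply: ndc; exists d => //; apply: XY.
Qed.

Definition ses_conflict_free Z : Prop :=
  forall e e', Z e -> Z e' -> ~ ses_conf s e e'.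

Definition ses_en W Z : Prop :=
  [/\ W `<=` ses_E s, Z `<=` ses_E s, ses_conflict_free Z &
      Z `<=` ses_enabled W].

Lemma ses_enE W Z : ses_en W Z -> W `<=` ses_E s /\ Z `<=` ses_E s.
Proof. by case. Qed.

Definition rces_of_ses : RCES U := MkRCES ses_enE.

(** The invariant of reachable sets. Where it fails the steps may differ: an SES step checks only
    the new events, an RCES step all events of the target. *)
Definition ses_secured X : Prop := X `<=` ses_E s /\ X `<=` ses_enabled X.

Lemma ses_step_enabled X Y :
  ses_secured X -> ses_step s X Y -> Y `<=` ses_enabled X.
Proof.
move=> [_ Xen] [_ _ _ YX] e Ye.
by have [/Xen//|nXe] := pselect (X e); apply: YX.
Qed.

Lemma ses_step_secured X Y : ses_secured X -> ses_step s X Y -> ses_secured Y.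
Proof.
move=> SX /[dup] XY [YE [sXY _] _ _]; split=> // e Ye.
exact: ses_enabled_mono sXY (ses_step_enabled SX XY Ye).
Qed.

Lemma ses_stepE X Y :
  ses_secured X -> ses_step s X Y <-> rces_step rces_of_ses X Y.
Proof.
move=> SX; split=> [/[dup] XY [YE sXY cfY _]|[YE sXY XY]].
(* One witness [W = X] serves every [Z], since conflict-freeness and enabledness of all events pass
   from [Y] to its subsets. *)
- split=> // Z ZY; exists X => //; split.
  + by case: SX.
  + exact: subset_trans ZY YE.
  + by move=> e e' /ZY Ye /ZY; apply: cfY.
  + exact: subset_trans ZY (ses_step_enabled SX XY).
(* The instance [Z = Y] carries all the information; monotonicity lifts enabledness from [W] to
   [X]. *)
- have [W WX [_ _ cfY Yen]] := XY Y (@subset_refl _ Y).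
  by split=> // e [/Yen We _]; apply: ses_enabled_mono WX We.
Qed.

Lemma trans_equiv_rces_of_ses : trans_equiv (ses_ts s) (rces_ts rces_of_ses).
Proof.
apply: (@trans_equiv_invariant _ _ _ ses_secured) => //.
- by split; apply: sub0set.
- exact: ses_step_secured.
- exact: ses_stepE.
Qed.

End SESToRCES.

Section NoSES.
Variables (U : Type) (a b : U).
Implicit Types W Z : set U.

Definition seq_en W Z : Prop :=
  [/\ W `<=` [set a; b], Z `<=` [set a; b] & Z a -> Z b -> W a].

Lemma seq_enE W Z : seq_en W Z -> W `<=` [set a; b] /\ Z `<=` [set a; b].
Proof. by case. Qed.

Definition seq_rces : RCES U := MkRCES seq_enE.

Hypothesis ab : a <> b.

Lemma seq_rces_step_single x : [set a; b] x ->
  rces_step seq_rces set0 [set x].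
Proof.
move=> abx; have xab : [set x] `<=` [set a; b] by move=> _ ->.
split=> //; first by split=> // /(_ x erefl).
move=> Z Zx; exists set0 => //; split=> // [|Za Zb].
- exact: subset_trans Zx xab.
(* A subset of a singleton cannot contain both [a] and [b]. *)
- by case: ab; rewrite (Zx _ Za) (Zx _ Zb).
Qed.

Lemma seq_rces_step_pair : rces_step seq_rces [set a] [set a; b].
Proof.
have aab : [set a] `<=` [set a; b] by move=> _ ->; left.
split=> //; last by move=> Z Zab; exists [set a].
by split=> // /(_ b (or_intror erefl)) /esym.
Qed.

Lemma seq_rces_nstep : ~ rces_step seq_rces set0 [set a; b].
Proof.
move=> [_ _ /(_ _ (@subset_refl _ _)) [W W0 [_ _ Wa]]].
by apply: (W0 a); apply: Wa; [left | right].
Qed.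

Lemma seq_rces_not_ses (s : SES U) :
  ~ trans_equiv (rces_ts seq_rces) (ses_ts s).
Proof.
move=> [_ RS]; set r := rces_ts seq_rces in RS.
have C0 : configs r set0 by exact: configs0.
have C1 x : [set a; b] x -> configs r [set x].
  move=> abx; apply: configs_step C0 (seq_rces_step_single abx) _ _ => //.
  by move=> _ ->.
have C2 : configs r [set a; b].
  have Ca : configs r [set a] by apply: C1; left.
  exact: configs_step Ca seq_rces_step_pair _ _.
have ses_stepP X Y : configs r X -> configs r Y -> step r X Y ->
    ses_step s X Y.
  move=> CX CY XY; have: reach_steps r (X, Y) by split.
  by rewrite RS => -[].
have S1 x : [set a; b] x -> ses_step s set0 [set x].
  by move=> abx; apply: ses_stepP (C1 x abx) (seq_rces_step_single abx).
(* Conflict-freeness concerns the target alone, so [cf2] can be reused for the step from [set0]. *)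
have [E2 _ cf2 _] : ses_step s [set a] [set a; b].
  by apply: ses_stepP C2 seq_rces_step_pair; apply: C1; left.
have S2 : ses_step s set0 [set a; b].
  split=> //; first by split=> // /(_ a (or_introl erefl)).
  (* The step from [set0] to [[set e]] shows that [e] is enabled at [set0]. *)
  by move=> e [/S1 [_ _ _ en] _]; apply: en; split.
apply: seq_rces_nstep.
suff: reach_steps r (set0, [set a; b]) by case.
rewrite RS; split=> //; split=> /=; first exact: configs0.
exact: configs_step (configs0 (ses_ts s)) S2 E2 _.
Qed.

End NoSES.

(** If every element equalled a chosen [a], the type would lie in a singleton and be finite. *)
Lemma infinite_setT_neq (U : Type) :
  infinite_set [set: U] -> exists a b : U, a <> b.
Proof.
move=> Uinf; have [a _] := infinite_setN0 Uinf; exists a.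
apply: contrapT => nab; apply: Uinf.
apply: (sub_finite_set _ (finite_set1 a)) => b _ /=.
by apply: contrapT => ba; apply: nab; exists b => /esym.
Qed.

Theorem theorem4p20 :
  (forall (U : Type) (s : SES U),
     exists r : RCES U, trans_equiv (ses_ts s) (rces_ts r)) /\
  (forall U : Type, infinite_set [set: U] ->
     exists r : RCES U, forall s : SES U,
       ~ trans_equiv (rces_ts r) (ses_ts s)).
Proof.
split=> [U s|U /infinite_setT_neq [a [b ab]]].
- by exists (rces_of_ses s); apply: trans_equiv_rces_of_ses.
- by exists (seq_rces a b) => s; apply: seq_rces_not_ses.
Qed.
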